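(* Let $0<q<1$, let $c$ be a real number, and let $Ai_q(x)={}_1\phi_1(0;-q;q,-x)$ be the $q$-Airy function. Then for real $x$: $$\sum_{n=0}^\infty(-1)^nq^n\big(c-1+q^2+q^nx\big)Ai_q(q^nx)=\frac{qc+x}{q(1+q)}\,{}_1\phi_1(0;-q^2;q,-x)-(1-q)Ai_q(\tfrac xq),$$ $$\sum_{n=0}^\infty(-1)^nq^n\big(1-q^2-q^nx\big)Ai_q(q^nx)=(1-q)Ai_q(\tfrac xq)-\frac{x}{q(1+q)}\,{}_1\phi_1(0;-q^2;q,-x),$$ $$\sum_{n=0}^\infty q^n\big(q^nx-q+q^3\big)(-q^{-3}x;q)_n\,Ai_q(q^nx)=\frac{x}{1+q}\,{}_1\phi_1(0;-q^2;q,-x)-\Big(q(1+q)+\frac xq\Big)Ai_q(\tfrac xq).$$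
   Context: $(a;q)_k=\prod_{j=0}^{k-1}(1-aq^j)$. The basic hypergeometric series is ${}_1\phi_1(a;b;q,z)=\sum_{k\ge0}\frac{(a;q)_k}{(q;q)_k(b;q)_k}(-1)^kq^{\binom k2}z^k$; thus ${}_1\phi_1(0;b;q,-x)=\sum_{k\ge0}\frac{q^{\binom k2}x^k}{(q;q)_k(b;q)_k}$. *)

(* Defs.v *)
From Stdlib Require Import Reals.
From Coquelicot Require Import Coquelicot.
Open Scope R_scope.

(** [(a;q)_k = (1 - a) (1 - a q) ... (1 - a q^(k-1))]. *)
Fixpoint qpoch (a q : R) (k : nat) : R :=
  match k with
  | O => 1
  | S j => qpoch a q j * (1 - a * q ^ j)
  end.

(** The basic hypergeometric series [1phi1(a; b; q, z)].  The exponent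
    [k (k - 1) / 2] is the binomial coefficient [k choose 2]; the division is
    exact, and the truncated subtraction is harmless at [k = 0]. *)
Definition phi11 (a b q z : R) : R :=
  Series (fun k : nat =>
    qpoch a q k / (qpoch q q k * qpoch b q k)
    * (-1) ^ k * q ^ (k * (k - 1) / 2)%nat * z ^ k).

(** The q-Airy function. *)
Definition Aiq (q x : R) : R := phi11 0 (- q) q (- x).

(* Main.v *)
Require Import Defs.
From Stdlib Require Import Reals Lra Lia.
From Coquelicot Require Import Coquelicot.
Open Scope R_scope.

(** Write [A = Ai_q] and [B = 1phi1(0; -q^2; q, -x)].  Comparing coefficients,
    [A (x/q) - A (q x) = (x/q) A x], [x B x = q (1+q) (A (x/q) - A x)] and
    [B x + q B (q x) = (1+q) A x].  These make all the series telescope: the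
    summands are [u n - u (n+1)] with
    - [(1+q) u n = (-q)^n B (q^n x)] for the part of the first series that is
      proportional to [c] (the rest of it is minus the second series);
    - [u n = (-q)^n F (q^n x)], [F x = A x - q A (x/q)], for the second series;
    - [u n = q^n (-q^-3 x; q)_n G (q^n x)],
      [G x = - q A x - (q^2 + x/q) A (x/q)], for the third one. *)

(** * Telescoping sums, and estimates for [q ^ n] and [qpoch] *)

Lemma is_series_telescope (u : nat -> R) :
  is_lim_seq u 0 -> is_series (fun n => u n - u (S n)) (u O).
Proof.
intros Hu.
change (is_lim_seq (sum_n (fun n => u n - u (S n))) (u O)).
apply (is_lim_seq_ext (fun n => u O - u (S n))).
- intros n; induction n as [|n IH].
  + now rewrite sum_O.
  + rewrite sum_Sn, <- IH; unfold plus; simpl; ring.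
- replace (u O) with (u O - 0) at 1 by ring.
  apply is_lim_seq_minus'; [apply is_lim_seq_const|].
  now apply (is_lim_seq_incr_1 u).
Qed.

Lemma pow_unit_interval (q : R) (n : nat) :
  0 < q -> q < 1 -> 0 < q ^ n <= 1.
Proof.
intros q0 q1; split; [now apply pow_lt|].
rewrite <- (pow1 n); apply pow_incr; lra.
Qed.

Lemma pow_S_unit_interval (q : R) (n : nat) :
  0 < q -> q < 1 -> 0 < q ^ S n < 1.
Proof.
intros q0 q1; simpl.
destruct (pow_unit_interval q n q0 q1); nra.
Qed.

Lemma qpoch_pos (a q : R) (k : nat) :
  0 < q -> q < 1 -> a < 1 -> 0 < qpoch a q k.
Proof.
intros q0 q1 a1; induction k as [|k IH]; simpl; [lra|].
apply Rmult_lt_0_compat; [exact IH|].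
destruct (pow_unit_interval q k q0 q1); nra.
Qed.

Lemma qpoch_0 (q : R) (k : nat) : qpoch 0 q k = 1.
Proof. induction k as [|k IH]; simpl; [|rewrite IH]; ring. Qed.

(** Both sides equal $(a;q)_{k+1}$, with the first factor split off on the left and the last one on
    the right. *)
Lemma qpoch_shift (a q : R) (k : nat) :
  qpoch (a * q) q k * (1 - a) = qpoch a q k * (1 - a * q ^ k).
Proof.
induction k as [|k IH]; simpl; [ring|].
replace (qpoch (a * q) q k * (1 - a * q * q ^ k) * (1 - a))
  with (qpoch (a * q) q k * (1 - a) * (1 - a * q * q ^ k)) by ring.
rewrite IH; ring.
Qed.

(* Since [q^j = (q^j - q^(j+1)) / (1 - q)], the product of the
   bounds [exp (|a| q^j)] telescopes. *)
Lemma qpoch_bound (a q : R) (k : nat) :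
  0 < q -> q < 1 -> Rabs (qpoch a q k) <= exp (Rabs a * (1 - q ^ k) / (1 - q)).
Proof.
intros q0 q1; induction k as [|k IH]; simpl.
- rewrite Rabs_R1; unfold Rdiv; rewrite Rminus_diag, Rmult_0_r, Rmult_0_l, exp_0.
  lra.
- replace (Rabs a * (1 - q * q ^ k) / (1 - q))
    with (Rabs a * (1 - q ^ k) / (1 - q) + Rabs a * q ^ k) by (field; lra).
  rewrite exp_plus, Rabs_mult.
  apply Rmult_le_compat; try apply Rabs_pos; [exact IH|].
  destruct (pow_unit_interval q k q0 q1) as [p0 _].
  apply Rle_trans with (1 + Rabs a * q ^ k); [|apply exp_ineq1_le].
  unfold Rminus; eapply Rle_trans; [apply Rabs_triang|].
  rewrite Rabs_R1, Rabs_Ropp, Rabs_mult, (Rabs_pos_eq (q ^ k)); lra.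
Qed.

(** * The series ${}_1\phi_1(0;b;q,-x)$ as an entire power series in [x] *)

Definition phi_coef (b q : R) (k : nat) : R :=
  q ^ (k * (k - 1) / 2)%nat / (qpoch q q k * qpoch b q k).

(** The sign $(-1)^k$ in the series cancels the one in $(-x)^k$, and $(0;q)_k = 1$. *)
Lemma phi11_0E (b q x : R) : phi11 0 b q (- x) = PSeries (phi_coef b q) x.
Proof.
apply Series_ext; intros k; unfold phi_coef.
rewrite qpoch_0.
replace (- x) with ((-1) * x) by ring.
rewrite Rpow_mult_distr.
assert (E : (-1) ^ k * (-1) ^ k = 1)
  by (rewrite <- Rpow_mult_distr; replace (-1 * -1) with 1 by ring; apply pow1).
unfold Rdiv.
transitivity ((-1) ^ k * (-1) ^ k
  * (q ^ (k * (k - 1) / 2) * / (qpoch q q k * qpoch b q k) * x ^ k)); [ring|].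
rewrite E; ring.
Qed.

Lemma phi_coef_pos (b q : R) (k : nat) :
  0 < q -> q < 1 -> b < 1 -> 0 < phi_coef b q k.
Proof.
intros q0 q1 b1; apply Rdiv_lt_0_compat; [now apply pow_lt|].
apply Rmult_lt_0_compat; now apply qpoch_pos.
Qed.

(** The ratio of consecutive coefficients, with denominators cleared. Every functional equation that
    shifts the index rests on it. *)
Lemma phi_coef_S (b q : R) (k : nat) : 0 < q -> q < 1 -> b < 1 ->
  phi_coef b q (S k) * ((1 - q ^ S k) * (1 - b * q ^ k))
  = q ^ k * phi_coef b q k.
Proof.
intros q0 q1 b1; unfold phi_coef.
(* The numerators differ by [k * 2], which passes through the integer division. *)
assert (E : (S k * (S k - 1) / 2 = k * (k - 1) / 2 + k)%nat).
{ rewrite <- Nat.div_add by lia; f_equal; nia. }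
rewrite E, pow_add.
assert (H1 := qpoch_pos q q k q0 q1 q1).
assert (H2 := qpoch_pos b q k q0 q1 b1).
destruct (pow_S_unit_interval q k q0 q1) as [H3 H4].
destruct (pow_unit_interval q k q0 q1) as [H5 H6].
assert (H7 : 0 < 1 - b * q ^ k) by nra.
simpl in *; field; repeat split; lra.
Qed.

(** By [phi_coef_S] the ratio of consecutive coefficients is $q^k / ((1-q^{k+1})(1-bq^k))$, which
    tends to 0. *)
Lemma CV_radius_phi_coef (b q : R) :
  0 < q -> q < 1 -> b < 1 -> CV_radius (phi_coef b q) = p_infty.
Proof.
intros q0 q1 b1; apply CV_radius_infinite_DAlembert.
- intros k; apply Rgt_not_eq; now apply phi_coef_pos.
- assert (G : is_lim_seq (fun k => q ^ k) 0)
    by (apply is_lim_seq_geom; rewrite Rabs_pos_eq; lra).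
  apply is_lim_seq_ext
    with (fun k => q ^ k / ((1 - q ^ S k) * (1 - b * q ^ k))).
  + intros k.
    assert (H := phi_coef_S b q k q0 q1 b1).
    assert (P := phi_coef_pos b q k q0 q1 b1).
    assert (P' := phi_coef_pos b q (S k) q0 q1 b1).
    destruct (pow_S_unit_interval q k q0 q1) as [H3 H4].
    destruct (pow_unit_interval q k q0 q1) as [H5 H6].
    assert (H7 : 0 < 1 - b * q ^ k) by nra.
    rewrite Rabs_pos_eq by (apply Rlt_le, Rdiv_lt_0_compat; assumption).
    apply Rmult_eq_reg_r with
      (phi_coef b q k * ((1 - q ^ S k) * (1 - b * q ^ k))).
    2: { apply Rgt_not_eq, Rmult_lt_0_compat; [lra|].
         apply Rmult_lt_0_compat; lra. }
    transitivity (q ^ k * phi_coef b q k); [field; lra|].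
    rewrite <- H; field; lra.
  + replace 0 with (0 / ((1 - 0) * (1 - b * 0))) by field.
    apply is_lim_seq_div'; [exact G| |lra].
    apply is_lim_seq_mult'; apply is_lim_seq_minus'; try apply is_lim_seq_const.
    * now apply (is_lim_seq_incr_1 (fun k => q ^ k)).
    * apply is_lim_seq_mult'; [apply is_lim_seq_const|exact G].
Qed.

Lemma ex_series_phi_coef (b q x : R) : 0 < q -> q < 1 -> b < 1 ->
  ex_series (fun k => phi_coef b q k * x ^ k).
Proof.
intros q0 q1 b1.
apply ex_series_Rabs, CV_disk_inside.
rewrite CV_radius_phi_coef; easy.
Qed.

(** Continuity at 0 of an entire function. The telescoping arguments only use that the limit is
    finite; it is left as [- 0] so that [b = - q] gives [Aiq q 0] by unfolding. *)
Lemma is_lim_seq_phi11_geom (b q x : R) : 0 < q -> q < 1 -> b < 1 ->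
  is_lim_seq (fun n => phi11 0 b q (- (q ^ n * x))) (phi11 0 b q (- 0)).
Proof.
intros q0 q1 b1.
apply is_lim_seq_ext with (fun n => PSeries (phi_coef b q) (q ^ n * x)).
{ intros n; now rewrite phi11_0E. }
rewrite phi11_0E.
apply is_lim_seq_continuous.
- apply PSeries_continuity.
  rewrite CV_radius_phi_coef; easy.
- replace 0 with (0 * x) by ring.
  apply is_lim_seq_mult'; [|apply is_lim_seq_const].
  apply is_lim_seq_geom; rewrite Rabs_pos_eq; lra.
Qed.

(** * Functional equations between [Aiq] and ${}_1\phi_1(0;-q^2;q,-x)$ *)

(** This is [qpoch_shift] at [a = - q], read in the denominators. *)
Lemma phi_coef_shift (q : R) (k : nat) : 0 < q -> q < 1 ->
  phi_coef (- q ^ 2) q k * (1 + q ^ S k) = (1 + q) * phi_coef (- q) q k.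
Proof.
intros q0 q1; unfold phi_coef.
assert (S1 := qpoch_shift (- q) q k).
replace (- q * q) with (- q ^ 2) in S1 by ring.
assert (q2 : - q ^ 2 < 1) by nra.
assert (q3 : - q < 1) by lra.
assert (P := qpoch_pos q q k q0 q1 q1).
assert (P1 := qpoch_pos (- q) q k q0 q1 q3).
assert (P2 := qpoch_pos (- q ^ 2) q k q0 q1 q2).
apply Rmult_eq_reg_r with
  (qpoch q q k * qpoch (- q ^ 2) q k * qpoch (- q) q k).
2: { apply Rgt_not_eq; repeat apply Rmult_lt_0_compat; assumption. }
transitivity (q ^ (k * (k - 1) / 2) * (qpoch (- q) q k * (1 - - q * q ^ k))).
{ simpl in *; field; lra. }
rewrite <- S1; simpl in *; field; lra.
Qed.

(** On the left the coefficient of $x^k$ carries the factor $1 + q \cdot q^k$, which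
    [phi_coef_shift] absorbs. *)
Lemma phi11_Aiq (q x : R) : 0 < q -> q < 1 ->
  phi11 0 (- q ^ 2) q (- x) + q * phi11 0 (- q ^ 2) q (- (q * x))
  = (1 + q) * Aiq q x.
Proof.
intros q0 q1; unfold Aiq; rewrite !phi11_0E; unfold PSeries.
assert (q2 : - q ^ 2 < 1) by nra.
rewrite <- !Series_scal_l, <- Series_plus.
- apply Series_ext; intros k.
  rewrite Rpow_mult_distr.
  transitivity ((1 + q) * phi_coef (- q) q k * x ^ k); [|ring].
  rewrite <- phi_coef_shift by assumption; simpl; ring.
- now apply ex_series_phi_coef.
- apply (ex_series_scal_l q (fun k => phi_coef (- q ^ 2) q k * (q * x) ^ k)).
  now apply ex_series_phi_coef.
Qed.

(** The constant terms cancel. In powers of [x / q], the coefficient of index [S k] carries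
    $1-q^{2(k+1)} = (1-q^{k+1})(1+q^{k+1})$, exactly the factor in [phi_coef_S] for [b = - q]. *)
Lemma Aiq_qdiff (q x : R) : 0 < q -> q < 1 ->
  Aiq q (x / q) - Aiq q (q * x) = x / q * Aiq q x.
Proof.
intros q0 q1; unfold Aiq; rewrite !phi11_0E; unfold PSeries.
assert (q2 : - q < 1) by lra.
assert (E := fun y => ex_series_phi_coef (- q) q y q0 q1 q2).
rewrite <- Series_minus, <- Series_scal_l, Series_incr_1; try easy.
2: { apply (ex_series_minus
       (fun k => phi_coef (- q) q k * (x / q) ^ k)
       (fun k => phi_coef (- q) q k * (q * x) ^ k)); apply E. }
rewrite !pow_O, Rminus_diag, Rplus_0_l.
apply Series_ext; intros k.
replace (q * x) with (q ^ 2 * (x / q)) by (field; lra).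
replace (x ^ k) with (q ^ k * (x / q) ^ k)
  by (rewrite <- Rpow_mult_distr; f_equal; field; lra).
transitivity (x / q * (x / q) ^ k * (q ^ k * phi_coef (- q) q k)); [|ring].
rewrite <- phi_coef_S by assumption.
rewrite Rpow_mult_distr, <- pow_mult.
replace (q ^ (2 * S k)) with (q ^ S k * q ^ S k)
  by (rewrite <- pow_add; f_equal; lia).
simpl; ring.
Qed.

(** As for [Aiq_qdiff], but the difference now carries only $1-q^{k+1}$; the missing $1+q^{k+1}$
    turns the parameter $-q$ into $-q^2$. *)
Lemma Aiq_phi11 (q x : R) : 0 < q -> q < 1 ->
  Aiq q (x / q) - Aiq q x
  = x / (q * (1 + q)) * phi11 0 (- q ^ 2) q (- x).
Proof.
intros q0 q1; unfold Aiq; rewrite !phi11_0E; unfold PSeries.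
assert (q2 : - q < 1) by lra.
assert (E := fun y => ex_series_phi_coef (- q) q y q0 q1 q2).
rewrite <- Series_minus, <- Series_scal_l, Series_incr_1; try easy.
2: { apply (ex_series_minus
       (fun k => phi_coef (- q) q k * (x / q) ^ k)
       (fun k => phi_coef (- q) q k * x ^ k)); apply E. }
rewrite !pow_O, Rminus_diag, Rplus_0_l.
apply Series_ext; intros k.
set (y := x / q).
replace x with (q * y) by (unfold y; field; lra).
rewrite !Rpow_mult_distr.
destruct (pow_S_unit_interval q k q0 q1) as [H3 H4].
(* This factor completes the product needed by [phi_coef_S] on the left and by [phi_coef_shift] on
   the right. *)
apply Rmult_eq_reg_r with (1 + q ^ S k); [|lra].
transitivity (y * y ^ k
  * (phi_coef (- q) q (S k) * ((1 - q ^ S k) * (1 - - q * q ^ k)))).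
{ simpl; ring. }
rewrite phi_coef_S by assumption.
transitivity (y / (1 + q) * (q ^ k * y ^ k)
  * (phi_coef (- q ^ 2) q k * (1 + q ^ S k))); [|field; lra].
rewrite phi_coef_shift by assumption; field; lra.
Qed.

(** * Limits along $q^n x$ and the telescoping series *)

Lemma is_lim_seq_Aiq_geom (q x : R) : 0 < q -> q < 1 ->
  is_lim_seq (fun n => Aiq q (q ^ n * x)) (Aiq q 0).
Proof. intros q0 q1; apply is_lim_seq_phi11_geom; lra. Qed.

(** Common shape of the telescoping sequences: [w] is constantly 1 in the alternating series and
    $(a;q)_n$ in the third one. *)
Lemma is_lim_seq_geom_bounded (r M l : R) (w v : nat -> R) :
  Rabs r < 1 -> (forall n, Rabs (w n) <= M) -> is_lim_seq v l ->
  is_lim_seq (fun n => r ^ n * w n * v n) 0.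
Proof.
intros r1 Hw Hv.
replace 0 with (0 * l) by ring.
apply is_lim_seq_mult'; [|exact Hv].
apply is_lim_seq_abs_0.
apply is_lim_seq_le_le with (fun _ => 0) (fun n => Rabs r ^ n * M).
- intros n; split; [apply Rabs_pos|].
  rewrite Rabs_mult, <- RPow_abs.
  apply Rmult_le_compat_l; [apply pow_le, Rabs_pos|apply Hw].
- apply is_lim_seq_const.
- replace 0 with (0 * M) by ring.
  apply is_lim_seq_mult'; [|apply is_lim_seq_const].
  apply is_lim_seq_geom; now rewrite Rabs_Rabsolu.
Qed.

Lemma is_series_alternating_qdiff (q l x : R) (F : R -> R) :
  0 < q -> q < 1 -> is_lim_seq (fun n => F (q ^ n * x)) l ->
  is_series
    (fun n => (-1) ^ n * q ^ n * (F (q ^ n * x) + q * F (q * (q ^ n * x))))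
    (F x).
Proof.
intros q0 q1 HF.
assert (H : is_series
  (fun n => (- q) ^ n * 1 * F (q ^ n * x)
     - (- q) ^ S n * 1 * F (q ^ S n * x)) ((- q) ^ 0 * 1 * F (q ^ 0 * x))).
{ apply (is_series_telescope (fun n => (- q) ^ n * 1 * F (q ^ n * x))).
  apply (is_lim_seq_geom_bounded (- q) 1 l (fun _ => 1)); [| |exact HF].
  - rewrite Rabs_Ropp, Rabs_pos_eq; lra.
  - intros _; rewrite Rabs_R1; lra. }
replace (F x) with ((- q) ^ 0 * 1 * F (q ^ 0 * x))
  by (simpl; rewrite !Rmult_1_l; reflexivity).
revert H; apply is_series_ext; intros n.
replace (q ^ S n * x) with (q * (q ^ n * x)) by (simpl; ring).
rewrite <- Rpow_mult_distr; replace (-1 * q) with (- q) by ring.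
simpl; ring.
Qed.

Lemma is_lim_seq_Aiq_geom_div (q x : R) : 0 < q -> q < 1 ->
  is_lim_seq (fun n => Aiq q (q ^ n * x / q)) (Aiq q 0).
Proof.
intros q0 q1.
apply is_lim_seq_ext with (fun n => Aiq q (q ^ n * (x / q))).
- intros n; f_equal; field; lra.
- now apply is_lim_seq_Aiq_geom.
Qed.

Lemma is_series_Aiq (q x : R) : 0 < q -> q < 1 ->
  is_series (fun n => (-1) ^ n * q ^ n * Aiq q (q ^ n * x))
    (phi11 0 (- q ^ 2) q (- x) / (1 + q)).
Proof.
intros q0 q1.
assert (q2 : - q ^ 2 < 1) by nra.
assert (H := is_series_alternating_qdiff q _ x
  (fun y => phi11 0 (- q ^ 2) q (- y)) q0 q1
  (is_lim_seq_phi11_geom (- q ^ 2) q x q0 q1 q2)).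
apply (is_series_scal_r (/ (1 + q))) in H.
revert H; apply is_series_ext; intros n.
rewrite phi11_Aiq by assumption; simpl; field; lra.
Qed.

Lemma is_series_Aiq_alternating (q x : R) : 0 < q -> q < 1 ->
  is_series
    (fun n => (-1) ^ n * q ^ n * (1 - q ^ 2 - q ^ n * x) * Aiq q (q ^ n * x))
    (Aiq q x - q * Aiq q (x / q)).
Proof.
intros q0 q1.
assert (H := is_series_alternating_qdiff q (Aiq q 0 - q * Aiq q 0) x
  (fun y => Aiq q y - q * Aiq q (y / q)) q0 q1).
cbv beta in H.
refine (is_series_ext _ _ _ _ (H _)).
(* In $F(y)+qF(qy)$ the outer terms form $-q(A(y/q)-A(qy)) = -yA(y)$, and the others give
   $(1-q^2)A(y)$. *)
- intros n; set (y := q ^ n * x).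
  replace (q * y / q) with y by (field; lra).
  assert (E := Aiq_qdiff q y q0 q1).
  replace (Aiq q (y / q)) with (Aiq q (q * y) + y / q * Aiq q y) by lra.
  simpl; field; lra.
- apply is_lim_seq_minus'; [now apply is_lim_seq_Aiq_geom|].
  apply is_lim_seq_mult'; [apply is_lim_seq_const|].
  now apply is_lim_seq_Aiq_geom_div.
Qed.

Lemma is_series_Aiq_qpoch (q x : R) : 0 < q -> q < 1 ->
  is_series
    (fun n => q ^ n * (q ^ n * x - q + q ^ 3) * qpoch (- (/ q ^ 3 * x)) q n
       * Aiq q (q ^ n * x))
    (- q * Aiq q x - (q ^ 2 + x / q) * Aiq q (x / q)).
Proof.
intros q0 q1.
set (a := - (/ q ^ 3 * x)).
set (G := fun y => - q * Aiq q y - (q ^ 2 + y / q) * Aiq q (y / q)).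
assert (G0 : is_lim_seq (fun n => G (q ^ n * x))
               (- q * Aiq q 0 - (q ^ 2 + 0 * x / q) * Aiq q 0)).
{ assert (X : is_lim_seq (fun n => q ^ n) 0)
    by (apply is_lim_seq_geom; rewrite Rabs_pos_eq; lra).
  apply is_lim_seq_minus'; apply is_lim_seq_mult';
    try apply is_lim_seq_const.
  - now apply is_lim_seq_Aiq_geom.
  - apply is_lim_seq_plus'; [apply is_lim_seq_const|].
    repeat (apply is_lim_seq_mult'; [|apply is_lim_seq_const]); exact X.
  - now apply is_lim_seq_Aiq_geom_div. }
(* Dropping $q^n$ from [qpoch_bound] makes the bound independent of [n]. *)
assert (W : forall n, Rabs (qpoch a q n) <= exp (Rabs a / (1 - q))).
{ intros n; eapply Rle_trans; [now apply qpoch_bound|].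
  assert (L : Rabs a * (1 - q ^ n) / (1 - q) <= Rabs a / (1 - q)).
  { apply Rmult_le_compat_r; [apply Rlt_le, Rinv_0_lt_compat; lra|].
    assert (A := Rabs_pos a).
    destruct (pow_unit_interval q n q0 q1); nra. }
  destruct L as [L|L]; [left; now apply exp_increasing|rewrite L; lra]. }
assert (q1' : Rabs q < 1) by (rewrite Rabs_pos_eq; lra).
assert (H := is_series_telescope (fun n => q ^ n * qpoch a q n * G (q ^ n * x))
  (is_lim_seq_geom_bounded q _ _ (qpoch a q) _ q1' W G0)).
replace (- q * Aiq q x - (q ^ 2 + x / q) * Aiq q (x / q))
  with (q ^ 0 * qpoch a q 0 * G (q ^ 0 * x))
  by (simpl; rewrite !Rmult_1_l; reflexivity).
revert H; apply is_series_ext; intros n.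
replace (q ^ S n * x) with (q * (q ^ n * x)) by (simpl; ring).
change (qpoch a q (S n)) with (qpoch a q n * (1 - a * q ^ n)).
set (y := q ^ n * x).
(* The new factor is $1+y/q^3$, and $q^2(1+y/q^3) = q^2+y/q$. Hence $A(y/q)$ and $A(qy)$ get
   opposite coefficients in the difference, and [Aiq_qdiff] reduces it to a multiple of $A(y)$. *)
replace (a * q ^ n) with (- (y / q ^ 3)) by (unfold a, y; field; lra).
unfold G.
replace (q * y / q) with y by (field; lra).
assert (E := Aiq_qdiff q y q0 q1).
replace (Aiq q (y / q)) with (Aiq q (q * y) + y / q * Aiq q y) by lra.
simpl; field; lra.
Qed.

Theorem theorem2p6 (q c x : R) (hq0 : 0 < q) (hq1 : q < 1) :
  is_series
    (fun n : nat =>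
       (-1) ^ n * q ^ n * (c - 1 + q ^ 2 + q ^ n * x) * Aiq q (q ^ n * x))
    ((q * c + x) / (q * (1 + q)) * phi11 0 (- q ^ 2) q (- x)
     - (1 - q) * Aiq q (x / q))
  /\
  is_series
    (fun n : nat =>
       (-1) ^ n * q ^ n * (1 - q ^ 2 - q ^ n * x) * Aiq q (q ^ n * x))
    ((1 - q) * Aiq q (x / q)
     - x / (q * (1 + q)) * phi11 0 (- q ^ 2) q (- x))
  /\
  is_series
    (fun n : nat =>
       q ^ n * (q ^ n * x - q + q ^ 3) * qpoch (- (/ q ^ 3 * x)) q n
       * Aiq q (q ^ n * x))
    (x / (1 + q) * phi11 0 (- q ^ 2) q (- x)
     - (q * (1 + q) + x / q) * Aiq q (x / q)).
Proof.
assert (E := Aiq_phi11 q x hq0 hq1).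
assert (H2 : is_series
  (fun n => (-1) ^ n * q ^ n * (1 - q ^ 2 - q ^ n * x) * Aiq q (q ^ n * x))
  ((1 - q) * Aiq q (x / q) - x / (q * (1 + q)) * phi11 0 (- q ^ 2) q (- x))).
{ rewrite <- E.
  replace ((1 - q) * Aiq q (x / q) - (Aiq q (x / q) - Aiq q x))
    with (Aiq q x - q * Aiq q (x / q)) by ring.
  now apply is_series_Aiq_alternating. }
split; [|split; [exact H2|]].
(* The weight splits as $c-1+q^2+y = c-(1-q^2-y)$ with $y = q^n x$. *)
- assert (H := is_series_minus _ _ _ _
    (is_series_scal_l c _ _ (is_series_Aiq q x hq0 hq1)) H2).
  match goal with |- is_series _ ?l => match type of H with is_series _ ?m =>
    replace l with m by
      (unfold minus, plus, opp, scal; simpl; unfold mult; simpl; field; lra)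
  end end.
  revert H; apply is_series_ext; intros n.
  unfold minus, plus, opp, scal; simpl; unfold mult; simpl; ring.
- replace (x / (1 + q) * phi11 0 (- q ^ 2) q (- x)
           - (q * (1 + q) + x / q) * Aiq q (x / q))
    with (- q * Aiq q x - (q ^ 2 + x / q) * Aiq q (x / q)).
  + now apply is_series_Aiq_qpoch.
  (* By [E] this term is $q(A(x/q)-A(x))$, and its first half cancels the surplus $qA(x/q)$. *)
  + replace (x / (1 + q) * phi11 0 (- q ^ 2) q (- x))
      with (q * (x / (q * (1 + q)) * phi11 0 (- q ^ 2) q (- x)))
      by (field; lra).
    rewrite <- E; field; lra.
Qed.
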